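(* Let $G$ be a finite graph and let $A$ be a finite additive Abelian group. For any locally zero-sum function $b\in Z(G,A)$, \[ F^*(G,b;A)=\sum_{\substack{S\subseteq E(G),\\ G-S \text{ is } b\text{-compatible}}}(-1)^{|S|}\,|A|^{m(G-S)}. \]
   Context: Graphs are finite with vertex set $V(G)$ and edge set $E(G)$; multiple edges and loops are allowed. $c(G)$ is the number of connected components of $G$ and $m(G)=|E(G)|-|V(G)|+c(G)$. For $S\subseteq E(G)$, $G-S$ is the spanning subgraph obtained by deleting the edges in $S$ (keeping all vertices). $A$ is a finite additive Abelian group with identity $0$; $A^{E(G)}$ and $A^{V(G)}$ are the sets of functions $E(G)\to A$ and $V(G)\to A$. Fix an arbitrary edge orientation of $G$. For $v\in V(G)$ let $E^+(v)$ (resp. $E^-(v)$) be the set of edges whose head (resp. tail) is $v$ (a loop at $v$ belongs to both). The boundary of $f\in A^{E(G)}$ is $\partial f\in A^{V(G)}$, $\partial f(v)=\sum_{e\in E^+(v)}f(e)-\sum_{e\in E^-(v)}f(e)$. For $b\in A^{V(G)}$, an $(A,b)$-flow is an $f\in A^{E(G)}$ with $\partial f=b$; it is nowhere-zero if $f(e)\neq 0$ for all $e\in E(G)$. $F^*(G,b;A)$ is the number of nowhere-zero $(A,b)$-flows of $G$ (this number does not depend on the orientation). A function $b\in A^{V(G)}$ is a locally zero-sum function on a graph $H$ with vertex set $V(G)$ if $\sum_{v\in V(C)}b(v)=0$ for every connected component $C$ of $H$; in that case $H$ is called $b$-compatible. $Z(G,A)$ is the set of all $b\in A^{V(G)}$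 that are locally zero-sum on $G$. *)

(* Defs.v *)
From HB Require Import structures.
From mathcomp Require Import all_boot all_order all_algebra.

Set Implicit Arguments.
Unset Strict Implicit.
Unset Printing Implicit Defensive.

Import Order.TTheory GRing.Theory Num.Theory.
Local Open Scope ring_scope.

(* Finite undirected multigraphs: distinct edges may have the same ends, and
   an edge with a single end is a loop. *)
Record mgraph := MGraph {
  vertex : finType;
  edge : finType;
  ends : edge -> {set vertex};
  ends_card : forall e, (0 < #|ends e| <= 2)%N }.

Record orientation (G : mgraph) := Orientation {
  tail : edge G -> vertex G;
  head : edge G -> vertex G;
  orientation_ends : forall e, ends e = [set tail e; head e] }.

(* G - S : spanning subgraph on the edges not in S. *)
Definition delete_edges (G : mgraph) (S : {set edge G}) : mgraph :=
  @MGraph (vertex G) {e : edge G | e \notin S}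
    (fun e => ends (val e)) (fun e => ends_card (val e)).

Definition adjacent (G : mgraph) : rel (vertex G) :=
  fun u v => [exists e : edge G, ends e == [set u; v]].

(* A connected component is represented by its vertex set. *)
Definition components (G : mgraph) : {set {set vertex G}} :=
  equivalence_partition (connect (@adjacent G)) [set: vertex G].

(* m(G) = |E| - |V| + c(G), valued in int to avoid truncated subtraction. *)
Definition cycle_rank (G : mgraph) : int :=
  #|edge G|%:Z - #|vertex G|%:Z + #|components G|%:Z.

Section Flows.

Variables (A : finZmodType) (G : mgraph).

(* "b is locally zero-sum on G", that is, "G is b-compatible". *)
Definition compatible (b : {ffun vertex G -> A}) : bool :=
  [forall C in components G, \sum_(v in C) b v == 0].

Definition locally_zero_sum : {set {ffun vertex G -> A}} :=
  [set b | compatible b].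

Variable D : orientation G.

Definition boundary (f : {ffun edge G -> A}) : {ffun vertex G -> A} :=
  [ffun v => \sum_(e | head D e == v) f e - \sum_(e | tail D e == v) f e].

Definition is_flow (b : {ffun vertex G -> A}) (f : {ffun edge G -> A}) : bool :=
  boundary f == b.

Definition nowhere_zero (f : {ffun edge G -> A}) : bool :=
  [forall e, f e != 0].

Definition num_nowhere_zero_flows (b : {ffun vertex G -> A}) : nat :=
  #|[set f : {ffun edge G -> A} | is_flow b f && nowhere_zero f]|.

End Flows.

Arguments compatible {A} G b.
Arguments locally_zero_sum A G : clear implicits.

(* Main.v *)
Require Import Defs.
From HB Require Import structures.
From mathcomp Require Import all_boot all_order all_algebra.

Set Implicit Arguments.
Unset Strict Implicit.
Unset Printing Implicit Defensive.

Import Order.TTheory GRing.Theory Num.Theory.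
Local Open Scope ring_scope.

(** The formula is inclusion-exclusion over the set [S] of edges on which a flow
    is required to vanish: the indicator of a nowhere-zero [f] is the
    alternating sum over [S] of the indicators that [f] vanishes on [S]
    ([nowhere_zero_alternating]), and the flows of [G] vanishing on [S] are the
    flows of [G - S] ([card_flows_vanishing]).  It remains to count all
    [(A, b)]-flows of a graph [H] without the nowhere-zero condition: there are
    [|A| ^ m(H)] of them if [H] is [b]-compatible, and none otherwise
    ([card_flows]).

    For that count, the boundary map is a homomorphism [A^E -> A^V] whose image
    is exactly the group [Z] of locally zero-sum functions ([boundary_image]):
    a function in [Z] is a sum of dipoles, each putting [a] at a vertex and [-a]
    at another vertex of the same component, and a dipole is the boundary of a
    flow of value [a] along a path.  All nonempty fibres of a homomorphism have
    the same size, so each [b] in [Z] has [|A|^|E| / |Z|] flows.  In turn [Z] is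
    the kernel of the homomorphism taking the sum over each component, which
    maps [A^V] onto [A^c(H)]; hence [|Z| = |A|^(|V| - c(H))]
    ([card_compatible]) and the quotient is [|A| ^ m(H)]. *)

(** * Fibres of additive maps *)

Section AdditiveFibres.

Variables (A : finZmodType) (I J : finType).
Variable h : {ffun I -> A} -> {ffun J -> A}.
Hypothesis hB : {morph h : x y / x - y}.

(** If [x] lies over [w] and [y] over [w'], adding [y - x] carries the first
    fibre onto the second. *)
Lemma card_fibre_translate w w' : w \in h @: setT -> w' \in h @: setT ->
  #|[set x | h x == w]| = #|[set x | h x == w']|.
Proof.
move=> /imsetP[x _ ->] /imsetP[y _ ->].
have h0 : h 0 = 0 by rewrite -(subrr 0) hB subrr.
have hN z : h (- z) = - h z by rewrite -sub0r hB h0 sub0r.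
rewrite -(card_imset _ (addIr (y - x))); apply: eq_card => z.
rewrite inE; apply/imsetP/eqP => [[u] | hz].
  by rewrite inE => /eqP hu ->; rewrite -[y - x]opprB !hB hu opprB addrC subrK.
exists (z + x - y); last by rewrite addrA subrK addrK.
by rewrite inE -[x in z + x]opprK !hB hN hz opprK [_ + h x]addrC addrK.
Qed.

Lemma card_image_fibre w : w \in h @: setT ->
  (#|A| ^ #|I| = #|h @: setT| * #|[set x | h x == w]|)%N.
Proof.
move=> hw; rewrite -card_ffun -cardsT -sum1_card (partition_big_imset h) /=.
rewrite -sum_nat_const; apply: eq_bigr => w' hw'.
rewrite (card_fibre_translate hw hw') -sum1_card.
by apply: eq_bigl => x; rewrite !inE.
Qed.

End AdditiveFibres.

(** * Locally zero-sum functions *)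

Section LocallyZeroSum.

Variables (A : finZmodType) (G : mgraph).

Lemma adjacent_sym : symmetric (@adjacent G).
Proof. by move=> u v; apply: eq_existsb => e; rewrite setUC. Qed.

Lemma connect_adjacent_equiv :
  {in [set: vertex G] & &, equivalence_rel (connect (@adjacent G))}.
Proof.
move=> u v w _ _ _; split=> [|huv]; first exact: connect0.
by apply: same_connect; first exact/sym_connect_sym/adjacent_sym.
Qed.

Lemma components_partition : partition (components G) [set: vertex G].
Proof. exact: equivalence_partitionP connect_adjacent_equiv. Qed.

Lemma mem_component_connect C u v :
  C \in components G -> u \in C -> connect (@adjacent G) u v = (v \in C).
Proof.
have /and3P[_ tP _] := components_partition.
move=> hC hu; rewrite -(def_pblock tP hC hu).
by rewrite (pblock_equivalence_partition connect_adjacent_equiv) ?inE.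
Qed.

(** The codomain is indexed by all vertex sets, padded with zeros outside the
    components, so that its image is a set of partial functions whose cardinal
    is [|A| ^ c(G)]. *)
Definition component_sums (b : {ffun vertex G -> A}) :
    {ffun {set vertex G} -> A} :=
  [ffun C => if C \in components G then \sum_(v in C) b v else 0].

Lemma component_sumsB : {morph component_sums : b c / b - c}.
Proof.
move=> b c; apply/ffunP=> C; rewrite !ffunE.
case: ifP => _; last by rewrite subr0.
by rewrite -sumrB; apply: eq_bigr => v _; rewrite !ffunE.
Qed.

Lemma component_sums_eq0 b : (component_sums b == 0) = compatible G b.
Proof.
apply/eqP/forall_inP => [hb C hC | hb].
  by move/ffunP/(_ C): hb; rewrite !ffunE hC => ->.
apply/ffunP=> C; rewrite !ffunE; case: ifP => // hC.
exact/eqP/hb.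
Qed.

(** To prescribe the component sums, pick one vertex per component and put the
    whole sum there. *)
Lemma component_sums_image :
  component_sums @: setT =i pffun_on 0 (components G) predT.
Proof.
move=> g; apply/imsetP/pffun_onP => [[b _ ->] | [/subsetP hg _]].
  split=> //; apply/subsetP => C; rewrite inE ffunE.
  by case: ifP => //; rewrite eqxx.
have trX := transversalP components_partition.
set X := transversal _ _ in trX.
have /and3P[_ tP _] := components_partition.
exists [ffun v => if v \in X then g (pblock (components G) v) else 0] => //.
apply/ffunP => C; rewrite ffunE; case: ifPn => hC; last first.
  by apply/eqP; apply: contraNT hC; apply: hg.
have /set0Pn[x0 _] : C != set0.
  by apply: contraTneq hC => ->; case/and3P: components_partition.
rewrite (eq_bigr (fun v => if v \in X then g C else 0)); last first.
  by move=> v hv; rewrite ffunE (def_pblock tP hC hv).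
rewrite -big_mkcondr.
rewrite (eq_bigl (mem (X :&: C))) => [|v]; last by rewrite !inE andbC.
by rewrite (setI_transversal_pblock trX x0 hC) big_set1.
Qed.

(** The locally zero-sum functions are the kernel of [component_sums], a map
    onto a group of order [|A| ^ c(G)]. *)
Lemma card_compatible :
  (#|A| ^ #|vertex G| =
     #|A| ^ #|components G| * #|[set b : {ffun _ -> A} | compatible G b]|)%N.
Proof.
have h0 : 0 \in component_sums @: setT.
  apply/imsetP; exists 0 => //; apply/esym/eqP; rewrite component_sums_eq0.
  by apply/forall_inP => C _; rewrite big1 // => v _; rewrite ffunE.
rewrite (card_image_fibre component_sumsB h0).
rewrite (eq_card component_sums_image) card_pffun_on cardT -cardE.
by congr (_ * _)%N; apply: eq_card => b; rewrite !inE component_sums_eq0.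
Qed.

End LocallyZeroSum.

(** * Counting all flows *)

Section AllFlows.

Variables (A : finZmodType) (G : mgraph) (D : orientation G).

Lemma boundaryB : {morph @boundary A G D : f g / f - g}.
Proof.
move=> f g; apply/ffunP=> v; rewrite !ffunE.
under eq_bigr do rewrite !ffunE.
under [X in _ - X]eq_bigr do rewrite !ffunE.
by rewrite !sumrB !opprD !opprK addrACA.
Qed.

(** Both ends of an edge lie in the same component, so [f e] is counted once
    with each sign in the sum over that component, or not at all. *)
Lemma boundary_compatible f : compatible G (@boundary A G D f).
Proof.
apply/forall_inP => C hC; apply/eqP.
under eq_bigr do rewrite ffunE.
have endE (p : edge G -> vertex G) :
    \sum_(v in C) \sum_(e | p e == v) f e = \sum_(e | p e \in C) f e.
  rewrite (partition_big p (mem C)) //=.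
  apply: eq_bigr => v hv; apply: eq_bigl => e.
  by case: eqP => [->|]; rewrite ?hv ?andbF.
rewrite sumrB !endE; apply/eqP; rewrite subr_eq0; apply/eqP/eq_bigl => e.
have adj : adjacent (Defs.head D e) (tail D e).
  by apply/existsP; exists e; rewrite (orientation_ends D) setUC.
have adj' : adjacent (tail D e) (Defs.head D e) by rewrite adjacent_sym.
by apply/idP/idP => h; rewrite -(mem_component_connect _ hC h) connect1.
Qed.

(** Writing the two ends as a difference, rather than by cases on [w], gives [0]
    when [u = v] and makes dipoles add up along paths with repeated vertices. *)
Definition dipole (u v : vertex G) (a : A) : {ffun vertex G -> A} :=
  [ffun w => a *+ (w == u) - a *+ (w == v)].

Lemma boundary_imageB b c : b \in @boundary A G D @: setT ->
  c \in @boundary A G D @: setT -> b - c \in @boundary A G D @: setT.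
Proof.
by move=> /imsetP[f _ ->] /imsetP[g _ ->]; rewrite -boundaryB imset_f.
Qed.

Lemma boundary_image0 : 0 \in @boundary A G D @: setT.
Proof. by rewrite -(subrr (boundary D 0)) -boundaryB imset_f. Qed.

Lemma boundary_imageD b c : b \in @boundary A G D @: setT ->
  c \in @boundary A G D @: setT -> b + c \in @boundary A G D @: setT.
Proof.
move=> hb hc; rewrite -[c]opprK -[- c]sub0r.
by rewrite !boundary_imageB ?boundary_image0.
Qed.

Lemma dipole_edge e a :
  dipole (Defs.head D e) (tail D e) a \in boundary D @: setT.
Proof.
apply/imsetP; exists [ffun e' => a *+ (e' == e)] => //.
have delta (p : edge G -> vertex G) w :
    \sum_(e' | p e' == w) a *+ (e' == e) = a *+ (w == p e).
  rewrite big_mkcond (bigD1 e) //= eqxx big1 ?addr0 => [|e' /negPf->].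
    by rewrite eq_sym; case: eqP.
  by case: ifP.
apply/ffunP => w; rewrite !ffunE.
under eq_bigr do rewrite ffunE.
under [X in _ = _ - X]eq_bigr do rewrite ffunE.
by rewrite !delta.
Qed.

(** Along a path from [u] to [v] the dipoles of consecutive vertices telescope
    to the dipole of the ends, and each of them is, up to sign, the boundary of
    a single edge carrying [a]. *)
Lemma dipole_connect u v a :
  connect (@adjacent G) u v -> dipole u v a \in boundary D @: setT.
Proof.
have dipoleN x y : dipole y x a = 0 - dipole x y a.
  by apply/ffunP => w; rewrite !ffunE sub0r opprB.
move=> /connectP[p]; elim: p u => [|w p IHp] u /= => [_ ->|].
  suff -> : dipole u u a = 0 by exact: boundary_image0.
  by apply/ffunP => x; rewrite !ffunE subrr.
case/andP=> /existsP[e /eqP he] hp hv.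
have -> : dipole u v a = dipole u w a + dipole w v a.
  by apply/ffunP => x; rewrite !ffunE addrA subrK.
apply: boundary_imageD; last exact: IHp.
move: he; rewrite (orientation_ends D) => he.
have : (tail D e \in [set u; w]) && (Defs.head D e \in [set u; w]).
  by rewrite -he !inE !eqxx orbT.
have : (u \in [set tail D e; Defs.head D e]) &&
       (w \in [set tail D e; Defs.head D e]).
  by rewrite he !inE !eqxx orbT.
(* The edge [e] may be traversed against or along its orientation. *)
have against :
    u = Defs.head D e -> w = tail D e -> dipole u w a \in boundary D @: setT.
  by move=> -> ->; apply: dipole_edge.
have along :
    u = tail D e -> w = Defs.head D e -> dipole u w a \in boundary D @: setT.
  move=> -> ->; rewrite dipoleN.
  by rewrite boundary_imageB ?boundary_image0 ?dipole_edge.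
rewrite !inE => /andP[/orP[] /eqP hu /orP[] /eqP hw].
- case/andP=> _ /orP[] /eqP hh; first by apply: along; rewrite // hw -hu.
  by apply: along.
- by move=> _; apply: along.
- by move=> _; apply: against.
case/andP=> /orP[] /eqP ht _; first by apply: against; rewrite // hw -hu.
by apply: against.
Qed.

(** With [r] a choice of root in each component, a locally zero-sum [b] is the
    sum over [v] of the dipoles moving [b v] from [r v] to [v]: the amounts
    taken at each root add up to the sum of [b] over its component, that is,
    to zero. *)
Lemma boundary_image :
  @boundary A G D @: setT = [set b : {ffun _ -> A} | compatible G b].
Proof.
apply/setP => b; rewrite inE; apply/idP/idP => [/imsetP[f _ ->] | hb].
  exact: boundary_compatible.
set r := fingraph.root (@adjacent G).
have csym : connect_sym (@adjacent G) by exact/sym_connect_sym/adjacent_sym.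
have sum0 w : \sum_(v | r v == w) b v = 0.
  have [hw | hw] := boolP [exists v, r v == w]; last first.
    rewrite big_pred0 // => v.
    by apply: contraNF hw => rvw; apply/existsP; exists v.
  case/existsP: hw => u /eqP <-.
  have hP := components_partition G.
  have hC : pblock (components G) u \in components G.
    by rewrite pblock_mem // (cover_partition hP).
  rewrite -[RHS](eqP (forall_inP hb _ hC)).
  apply: eq_bigl => v; rewrite /r eq_sym root_connect //.
  by rewrite (mem_component_connect _ hC) ?mem_pblock ?(cover_partition hP).
have -> : b = \sum_v dipole v (r v) (b v).
  apply/ffunP => w; rewrite sum_ffunE.
  under eq_bigr do rewrite ffunE.
  rewrite sumrB [X in _ - X](_ : _ = 0) ?subr0.
    rewrite (bigD1 w) //= eqxx big1 ?addr0 // => v.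
    by rewrite eq_sym => /negPf->.
  rewrite -[RHS](sum0 w) [RHS]big_mkcond; apply: eq_bigr => v _.
  by rewrite eq_sym; case: eqP.
elim/big_ind: _ => [||v _]; first exact: boundary_image0.
  exact: boundary_imageD.
by apply: dipole_connect; rewrite connect_root.
Qed.

(** From [|A|^|E| = |Z| N] and [|A|^|V| = |A|^c |Z|], where [Z] is the group of
    locally zero-sum functions and [N] the number of flows, one gets
    [N = |A|^(|E| - |V| + c)]. *)
Lemma card_flows (b : {ffun vertex G -> A}) :
  (#|[set f | is_flow D b f]|)%:R =
  if compatible G b then (#|A|%:R : rat) ^ cycle_rank G else 0.
Proof.
case: ifPn => hb; last first.
  rewrite eq_card0 // => f; rewrite !inE; apply: contraNF hb => /eqP <-.
  exact: boundary_compatible.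
have A0 : (#|A|%:R : rat) != 0.
  by rewrite pnatr_eq0 -lt0n; apply/card_gt0P; exists 0.
have him : b \in boundary D @: setT by rewrite boundary_image inE.
have hE := card_image_fibre boundaryB him.
have hV := card_compatible A G.
rewrite boundary_image in hE.
rewrite /cycle_rank !expfzDr // -invr_expz -!exprnP -!natrX hE hV !natrM.
have cA0 : (#|A| ^ #|components G|)%:R != 0 :> rat by rewrite natrX expf_neq0.
have kA0 : (#|[set c : {ffun _ -> A} | compatible G c]|)%:R != 0 :> rat.
  by rewrite pnatr_eq0 -lt0n; apply/card_gt0P; exists b; rewrite inE.
by rewrite invfM mulrA mulrAC divfK // mulrAC divff // mul1r.
Qed.

End AllFlows.

(** * Deleting edges *)

Section DeleteEdges.

Variables (A : finZmodType) (G : mgraph) (D : orientation G).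
Variable S : {set edge G}.

Definition delete_orientation : orientation (delete_edges S) :=
  @Orientation (delete_edges S) (fun e => tail D (val e))
    (fun e => Defs.head D (val e)) (fun e => orientation_ends D (val e)).

Definition extend0 (f : {ffun edge (delete_edges S) -> A}) :
    {ffun edge G -> A} :=
  [ffun e => if insub e is Some e' then f e' else 0].

Lemma extend0_val f e : extend0 f (val e) = f e.
Proof. by rewrite ffunE valK. Qed.

Lemma extend0_deleted f e : e \in S -> extend0 f e = 0.
Proof. by move=> he; rewrite ffunE insubN // negbK. Qed.

Lemma boundary_extend0 f :
  boundary D (extend0 f) = boundary delete_orientation f.
Proof.
have sumE (p : edge G -> vertex G) w :
    \sum_(e | p e == w) extend0 f e =
    \sum_(e : edge (delete_edges S) | p (val e) == w) f e.
  rewrite (bigID (mem S)) /= big1 ?add0r => [|e /andP[_ /extend0_deleted->]//].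
  under eq_bigl do rewrite andbC.
  rewrite (big_sub_cond [pred e | e \notin S] (fun e => p e == w)) /=.
  by apply: eq_bigr => e _; rewrite extend0_val.
by apply/ffunP => w; rewrite !ffunE !sumE.
Qed.

(** Extension by zero is a bijection between the flows of [G - S] and the flows
    of [G] that vanish on [S]. *)
Lemma card_flows_vanishing (b : {ffun vertex G -> A}) :
  #|[set f | is_flow D b f && [forall e in S, f e == 0]]| =
  #|[set f | is_flow delete_orientation b f]|.
Proof.
have injE : injective extend0.
  by move=> f g fg; apply/ffunP => e; rewrite -!extend0_val fg.
rewrite -(card_imset _ injE); apply: eq_card => f.
rewrite inE; apply/andP/imsetP => [[/eqP hf /forall_inP hS] | [g]].
  pose g : {ffun edge (delete_edges S) -> A} := [ffun e => f (val e)].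
  have fE : f = extend0 g.
    apply/ffunP => e; have [he | he] := boolP (e \in S).
      by rewrite extend0_deleted // (eqP (hS e he)).
    by rewrite -[e]/(val (Sub e he : edge (delete_edges S))) extend0_val ffunE.
  by exists g; rewrite // inE /is_flow -boundary_extend0 -fE hf.
rewrite inE => /eqP hg ->; split; first by rewrite /is_flow boundary_extend0 hg.
by apply/forall_inP => e he; rewrite extend0_deleted.
Qed.

End DeleteEdges.

(** * Inclusion-exclusion *)

(** Expand the product over all edges of [1 - [f e = 0]]. *)
Lemma nowhere_zero_alternating (A : finZmodType) (G : mgraph)
    (f : {ffun edge G -> A}) :
  (nowhere_zero f)%:R =
  \sum_(S : {set edge G}) (-1) ^+ #|S| * [forall e in S, f e == 0]%:R :> rat.
Proof.
have indE (P : pred (edge G)) (S : {set edge G}) :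
    [forall e in S, P e]%:R = \prod_(e in S) (P e)%:R :> rat.
  case: (boolP [forall e in S, P e]) => [/forall_inP hP | ].
    by rewrite big1 // => e /hP ->.
  case/forall_inPn=> e he /negPf hPe.
  by rewrite (bigD1 e) //= hPe mul0r.
have -> : nowhere_zero f = [forall e in [set: edge G], f e != 0].
  by apply: eq_forallb => e; rewrite inE.
rewrite indE (eq_bigl xpredT) => [|e]; last by rewrite inE.
have -> : \prod_e (f e != 0)%:R = \prod_e (- (f e == 0)%:R + 1) :> rat.
  by apply: eq_bigr => e _; case: eqP => _; rewrite ?addNr ?oppr0 ?add0r.
rewrite bigA_distr; apply: eq_bigr => S _.
by rewrite indE -big_mkcond /= prodrN.
Qed.

Theorem theorem1p1 (G : mgraph) (D : orientation G) (A : finZmodType)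
    (b : {ffun vertex G -> A}) (hb : b \in locally_zero_sum A G) :
  (num_nowhere_zero_flows D b)%:R =
  \sum_(S : {set edge G} | compatible (delete_edges S) b)
     (-1) ^+ #|S| * (#|A|%:R : rat) ^ cycle_rank (delete_edges S) :> rat.
Proof.
have cardE (P Q : pred {ffun edge G -> A}) :
    (#|[set f | P f && Q f]|)%:R = \sum_(f | P f) (Q f)%:R :> rat.
  rewrite -sum1_card natr_sum big_mkcond [RHS]big_mkcond.
  by apply: eq_bigr => f _; rewrite inE; case: (P f); case: (Q f).
rewrite /num_nowhere_zero_flows cardE.
under eq_bigr do rewrite nowhere_zero_alternating.
rewrite exchange_big [RHS]big_mkcond /=; apply: eq_bigr => S _.
rewrite -mulr_sumr -cardE card_flows_vanishing card_flows.
by case: ifP; rewrite ?mulr0.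
Qed.
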